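(* Let $T>0$, let the data $H,g,m_0,m_T$ satisfy the standing assumptions of the context, and let $(u,m)\in C^2(\overline{Q_T})\times C^1(\overline{Q_T})$ be a classical solution to (MFG) or (MFGP). Set $c_1:=\min(\min_{\mathbb T}m_0,\min_{\mathbb T}m(\cdot,T))$ and $C_1:=\max(\max_{\mathbb T}m_0,\max_{\mathbb T}m(\cdot,T))$. Then $$c_1\le m(x,t)\le C_1\qquad\text{for all }(x,t)\in\overline{Q_T}.$$
   Context: $\mathbb T$ is the one-dimensional torus (of length 1), $Q_T=\mathbb T\times(0,T)$, $\overline{Q_T}=\mathbb T\times[0,T]$. $H=H(p,m):\mathbb R\times(0,\infty)\to\mathbb R$ and $g:(0,\infty)\to\mathbb R$; subscripts denote partial derivatives. A classical solution has $m>0$ on $\overline{Q_T}$ and satisfies the equations pointwise. Systems: both (MFG) and (MFGP) consist of $$-u_t+H(u_x,m)=0,\qquad m_t-(mH_p(u_x,m))_x=0\quad\text{in }Q_T,\qquad m(\cdot,0)=m_0;$$ (MFG) has the terminal condition $u(\cdot,T)=g(m(\cdot,T))$, and (MFGP) has the terminal condition $m(\cdot,T)=m_T$. $C_0>0$, $\gamma>1$, $0<\alpha<1$ are constants and $\overline C:(0,\infty)\to(0,\infty)$ is a continuous function. Standing assumptions: (M) $m_0,m_T\in C^{2,\alpha}(\mathbb T)$, $m_0,m_T>0$, $\int_{\mathbb T}m_0=\int_{\mathbb T}m_T=1$. (H) $H,H_p,H_{pp}\in C^4(\mathbb R\times(0,\infty))$, $H_m<0$, and for all $(p,m)\in\mathbb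 R\times(0,\infty)$: $\frac1{C_0}(1+|p|)^{\gamma-2}\le H_{pp}\le\overline C(m)(1+|p|)^{\gamma-2}$; $pH_p\ge(1+\frac1{C_0})H-\overline C(m)$; $|H_{ppp}|\le\overline C(m)(1+|p|)^{\gamma-3}$; $|H_m|\le\overline C(m)(1+|p|)^\gamma$; $m|H_{mm}|\le-\overline C(m)H_m$; $|p||H_{mp}|\le-\overline C(m)H_m$; $m|p||H_{mmp}|\le-\overline C(m)H_m$; $|H_{mpp}|\le\overline C(m)(1+|p|)^{\gamma-2}$. (G) $g\in C^4(0,\infty)$ and $g'(m)>0$ for all $m>0$. (E) $-4mH_mH_{pp}\ge(1+\frac1{C_0})m^2H_{mp}^2$ for all $(p,m)\in\mathbb R\times(0,\infty)$. *)

(* Defs.v *)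
From Stdlib Require Import Reals.
From Coquelicot Require Import Coquelicot.
Open Scope R_scope.

Definition D1 (f : R -> R -> R) (x y : R) : R := Derive (fun x' => f x' y) x.
Definition D2 (f : R -> R -> R) (x y : R) : R := Derive (fun y' => f x y') y.

(** When [D] is open this is the usual [C^k(D)].  When [D] is the closure of its
    interior [O] it is [C^k] of the closure: the partial derivatives of order at
    most [k] exist in [O] and extend continuously to [D] ([f1] and [f2] below are
    these extensions). *)
Fixpoint Ck (k : nat) (D : R * R -> Prop) (f : R -> R -> R) : Prop :=
  continuous_on D (fun z : R * R => f (fst z) (snd z)) /\
  match k with
  | O => True
  | S k' => exists f1 f2 : R -> R -> R,
      Ck k' D f1 /\ Ck k' D f2 /\
      forall x y : R, locally (x, y) D ->
        is_derive (fun x' => f x' y) x (f1 x y) /\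
        is_derive (fun y' => f x y') y (f2 x y)
  end.

(** [C^k(D)] for an open subset [D] of the line. *)
Definition Ck_line (k : nat) (D : R -> Prop) (f : R -> R) : Prop :=
  forall x : R, D x ->
    (forall j : nat, (j <= k)%nat -> ex_derive_n f j x) /\
    continuous (Derive_n f k) x.

(** Functions on the torus of length 1 are the 1-periodic functions on the line. *)
Definition periodic1 (f : R -> R) : Prop := forall x : R, f (x + 1) = f x.

Definition C2alpha_torus (alpha : R) (f : R -> R) : Prop :=
  periodic1 f /\ Ck_line 2 (fun _ => True) f /\
  exists L : R, forall x y : R, x <> y ->
    Rabs (Derive_n f 2 x - Derive_n f 2 y) <= L * Rpower (Rabs (x - y)) alpha.

(** For a continuous periodic [f] these infimum and supremum are finite and
    attained, i.e. they are the minimum and the maximum over the torus. *)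
Definition min_torus (f : R -> R) : R := real (Glb_Rbar (fun y => exists x, y = f x)).
Definition max_torus (f : R -> R) : R := real (Lub_Rbar (fun y => exists x, y = f x)).

Definition half_plane (z : R * R) : Prop := 0 < snd z.

(** The closed cylinder [T x [0, T]], lifted to the line in its first variable. *)
Definition cylinder (T : R) (z : R * R) : Prop := 0 <= snd z <= T.

Record assumption_M (alpha : R) (m0 mT : R -> R) : Prop := {
  M_m0_reg : C2alpha_torus alpha m0;
  M_mT_reg : C2alpha_torus alpha mT;
  M_m0_pos : forall x, 0 < m0 x;
  M_mT_pos : forall x, 0 < mT x;
  M_m0_int : RInt m0 0 1 = 1;
  M_mT_int : RInt mT 0 1 = 1
}.

Record assumption_H (C0 gamma : R) (Cbar : R -> R) (H : R -> R -> R) : Prop := {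
  H_reg : Ck 4 half_plane H;
  Hp_reg : Ck 4 half_plane (D1 H);
  Hpp_reg : Ck 4 half_plane (D1 (D1 H));
  Hm_neg : forall p m, 0 < m -> D2 H p m < 0;
  Hpp_bounds : forall p m, 0 < m ->
    1 / C0 * Rpower (1 + Rabs p) (gamma - 2) <= D1 (D1 H) p m
      <= Cbar m * Rpower (1 + Rabs p) (gamma - 2);
  Hp_growth : forall p m, 0 < m ->
    p * D1 H p m >= (1 + 1 / C0) * H p m - Cbar m;
  Hppp_bound : forall p m, 0 < m ->
    Rabs (D1 (D1 (D1 H)) p m) <= Cbar m * Rpower (1 + Rabs p) (gamma - 3);
  Hm_bound : forall p m, 0 < m ->
    Rabs (D2 H p m) <= Cbar m * Rpower (1 + Rabs p) gamma;
  Hmm_bound : forall p m, 0 < m ->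
    m * Rabs (D2 (D2 H) p m) <= - Cbar m * D2 H p m;
  Hmp_bound : forall p m, 0 < m ->
    Rabs p * Rabs (D1 (D2 H) p m) <= - Cbar m * D2 H p m;
  Hmmp_bound : forall p m, 0 < m ->
    m * Rabs p * Rabs (D1 (D2 (D2 H)) p m) <= - Cbar m * D2 H p m;
  Hmpp_bound : forall p m, 0 < m ->
    Rabs (D1 (D1 (D2 H)) p m) <= Cbar m * Rpower (1 + Rabs p) (gamma - 2)
}.

Record assumption_G (g : R -> R) : Prop := {
  G_reg : Ck_line 4 (fun m => 0 < m) g;
  G_incr : forall m, 0 < m -> 0 < Derive g m
}.

Definition assumption_E (C0 : R) (H : R -> R -> R) : Prop :=
  forall p m, 0 < m ->
    - 4 * m * D2 H p m * D1 (D1 H) p m >= (1 + 1 / C0) * m ^ 2 * (D1 (D2 H) p m) ^ 2.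

Record classical_system (T : R) (H : R -> R -> R) (m0 : R -> R)
    (u m : R -> R -> R) : Prop := {
  u_periodic : forall t, 0 <= t <= T -> periodic1 (fun x => u x t);
  m_periodic : forall t, 0 <= t <= T -> periodic1 (fun x => m x t);
  u_reg : Ck 2 (cylinder T) u;
  m_reg : Ck 1 (cylinder T) m;
  m_pos : forall x t, 0 <= t <= T -> 0 < m x t;
  hamilton_jacobi : forall x t, 0 < t < T ->
    - D2 u x t + H (D1 u x t) (m x t) = 0;
  continuity_eq : forall x t, 0 < t < T ->
    D2 m x t - Derive (fun y => m y t * D1 H (D1 u y t) (m y t)) x = 0;
  initial_cond : forall x, m x 0 = m0 x
}.

Definition solution_MFG (T : R) (H : R -> R -> R) (g m0 : R -> R)
    (u m : R -> R -> R) : Prop :=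
  classical_system T H m0 u m /\ forall x, u x T = g (m x T).

Definition solution_MFGP (T : R) (H : R -> R -> R) (m0 mT : R -> R)
    (u m : R -> R -> R) : Prop :=
  classical_system T H m0 u m /\ forall x, m x T = mT x.

(* Main.v *)
Require Import Defs.
From Stdlib Require Import ZArith Reals Lra Psatz ClassicalEpsilon.
From Coquelicot Require Import Coquelicot.
Open Scope R_scope.

(** Put [v := u_x].  Differentiating the Hamilton-Jacobi equation in [x] and expanding
    the continuity equation turns the system into a first-order system for [(v, m)],
      [v_t = H_p v_x + H_m m_x],   [m_t = H_p m_x + m (H_pp v_x + H_mp m_x)],
    which involves first derivatives only and so makes sense for [m] of class C^1.
    The terms in [H_p] cancel in the Jacobian determinant of [(v, m)]:
      [v_x m_t - v_t m_x = m H_pp v_x^2 + m H_mp v_x m_x - H_m m_x^2].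
    Condition (E) says that the discriminant of this quadratic form in [(v_x, m_x)] is
    negative, so the form is positive definite: this is the ellipticity of the system
    ([pos_quadratic_form], [first_order_system]).

    On the other hand a Jacobian determinant is a null Lagrangian.  For [f] of class
    C^1, both [v] and [f] being periodic in [x],
      [d/dt (int v_x f dx) = int (v_x f_t - v_t f_x) dx]
    ([is_derive_RInt_null_lagrangian]).  Take [f := psi(m)] with [psi] nondecreasing of
    class C^1 and [psi(m) = 0] at times [0] and [T].  The right-hand side is the
    integral of [psi'(m)] times the quadratic form, hence [int v_x psi(m) dx] is
    nondecreasing in time; it vanishes at both ends, so it is constant and
    [psi'(m)] times the form is identically zero.  Where [psi'(m) <> 0] this gives
    [v_x = m_x = 0], thus [m_t = 0].  Consequently [psi(m)] does not depend on time and
    is zero ([density_truncation_vanishes]).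

    The upper bound is the case [psi(r) = ((r - C1)^+)^2] and the lower bound the case
    [psi(r) = -((c1 - r)^+)^2].  In both problems
    [psi(m)] vanishes at the end times because there [m] lies in [[c1, C1]]. *)

(** * Monotone functions with equal end values *)

(** A function with nonnegative derivative and equal end values is constant.  This one
    fact is used in time, for the integral identity, and in space, for an integral of
    a nonnegative function that vanishes. *)
Lemma monotone_flat (f f' : R -> R) (a b : R) :
  (forall x, a < x < b -> is_derive f x (f' x)) ->
  (forall x, a <= x <= b -> continuous f x) ->
  (forall x, a < x < b -> 0 <= f' x) ->
  f a = f b -> forall x, a < x < b -> f' x = 0.
Proof.
intros Hd Hc Hpos Hab.
assert (Hmono : forall x y, a <= x -> x <= y -> y <= b -> f x <= f y).
{ intros x y Hax Hxy Hyb.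
  (* The mean value theorem may return an end point, where nothing is known about the
     derivative of [f]; the derivative is therefore replaced by 0 outside (a, b). *)
  set (df := fun z => if Rlt_dec a z then if Rlt_dec z b then f' z else 0 else 0).
  destruct (MVT_gen f x y df) as [c [_ Hfc]].
  - rewrite Rmin_left, Rmax_right by lra.
    intros z Hz; unfold df.
    destruct (Rlt_dec a z); [|lra]; destruct (Rlt_dec z b); [|lra].
    apply Hd; lra.
  - rewrite Rmin_left, Rmax_right by lra.
    intros z Hz; apply continuity_pt_filterlim, Hc; lra.
  - assert (0 <= df c).
    { unfold df; destruct (Rlt_dec a c); [|lra]; destruct (Rlt_dec c b); [|lra].
      apply Hpos; lra. }
    nra. }
intros x Hx.
assert (Hcst : forall y, a < y < b -> f a = f y).
{ intros y Hy.
  assert (f a <= f y) by (apply Hmono; lra).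
  assert (f y <= f b) by (apply Hmono; lra).
  lra. }
rewrite <- (is_derive_unique f x _ (Hd x Hx)).
apply is_derive_unique.
apply is_derive_ext_loc with (fun _ => f a).
- apply (locally_interval _ x a b); simpl; try lra.
  intros y Hy1 Hy2; apply Hcst; simpl in *; lra.
- exact (is_derive_const (f a) x).
Qed.

Lemma RInt_nonneg_eq0 (f : R -> R) (a b : R) :
  (forall x, continuous f x) -> (forall x, 0 <= f x) ->
  RInt f a b = 0 -> forall x, a < x < b -> f x = 0.
Proof.
intros Hc Hpos H0.
assert (Hd : forall x, is_derive (fun y => RInt f a y) x (f x)).
{ intros x; apply is_derive_RInt with a; [|apply Hc].
  apply filter_forall; intros y; apply RInt_correct.
  apply @ex_RInt_continuous; intros z _; apply Hc. }
apply (monotone_flat (fun y => RInt f a y)).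
- intros x _; apply Hd.
- intros x _; apply @ex_derive_continuous; eexists; apply Hd.
- intros x _; apply Hpos.
- rewrite H0; exact (RInt_point a f).
Qed.

(** * Integrals depending on a parameter and partial derivatives *)

(** Joint continuity at the points of the compact segment [[a, b] x {p0}] is uniform in
    [x], by the existence of a Lebesgue number for the cover of [[a, b]] by intervals of
    uniform control.  The parameter lies in an arbitrary uniform space because a pair of
    times is needed later. *)
Lemma continuous_RInt_param {P : UniformSpace} (F : R -> P -> R) (a b : R) (p0 : P) :
  a <= b ->
  (forall x, a <= x <= b -> continuous (fun z : R * P => F (fst z) (snd z)) (x, p0)) ->
  locally p0 (fun p => ex_RInt (fun x => F x p) a b) ->
  continuous (fun p => RInt (fun x => F x p) a b) p0.
Proof.
intros Hab Hc Hex.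
apply filterlim_locally; intros eps.
set (e := eps / (2 * (b - a + 1))).
assert (He : 0 < e) by (apply Rdiv_lt_0_compat; [apply eps | lra]).
assert (Hd : forall x, exists d : posreal, a <= x <= b ->
  forall y p, Rabs (y - x) < d -> ball p0 d p -> Rabs (F y p - F x p0) < e / 2).
{ intros x.
  destruct (excluded_middle_informative (a <= x <= b)) as [Hx|Hx].
  - assert (He2 : 0 < e / 2) by lra.
    destruct (proj1 (filterlim_locally _ _) (Hc x Hx) (mkposreal _ He2)) as [d Hd].
    exists d; intros _ y p Hy Hp.
    exact (Hd (y, p) (conj Hy Hp)).
  - exists (mkposreal 1 Rlt_0_1); intros H; contradiction. }
assert (Hd' : exists delta : R -> posreal, forall x, a <= x <= b ->
  forall y p, Rabs (y - x) < delta x -> ball p0 (delta x) p ->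
    Rabs (F y p - F x p0) < e / 2).
{ exists (fun x => proj1_sig (constructive_indefinite_description _ (Hd x))).
  intros x; exact (proj2_sig (constructive_indefinite_description _ (Hd x))). }
destruct Hd' as [delta Hdelta].
destruct (compactness_value_1d a b delta) as [d Hcomp].
assert (Hunif : forall p, ball p0 d p ->
  forall x, a <= x <= b -> Rabs (F x p - F x p0) <= e).
{ intros p Hp x Hx; apply Rnot_lt_le; intros Hlt.
  apply (Hcomp x Hx); intros [t [Ht [Hxt Hdt]]].
  assert (Hpt : ball p0 (delta t) p) by (apply ball_le with d; assumption).
  assert (H1 := Hdelta t Ht x p Hxt Hpt).
  assert (H2 := Hdelta t Ht x p0 Hxt (ball_center _ _)).
  revert H1 H2 Hlt; unfold Rabs; repeat destruct Rcase_abs; lra. }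
assert (Hex0 := locally_singleton _ _ Hex).
generalize (filter_and _ _ Hex (locally_ball p0 d)).
apply filter_imp; intros p [Hexp Hball].
assert (Hle : norm (minus (RInt (fun x => F x p) a b) (RInt (fun x => F x p0) a b))
              <= (b - a) * e).
{ apply (norm_RInt_le_const (fun x => minus (F x p) (F x p0)) a b).
  - exact Hab.
  - intros x Hx; exact (Hunif p Hball x Hx).
  - apply @is_RInt_minus; apply @RInt_correct; assumption. }
apply Rle_lt_trans with (1 := Hle).
assert (e * (2 * (b - a + 1)) = eps) by (unfold e; field; lra).
nra.
Qed.

Lemma is_derive_comp_2d (f fx fy : R -> R -> R) (a b : R -> R) (t da db : R) :
  locally (a t, b t) (fun z => is_derive (fun x => f x (snd z)) (fst z) (fx (fst z) (snd z))) ->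
  is_derive (fun y => f (a t) y) (b t) (fy (a t) (b t)) ->
  continuous (fun z : R * R => fx (fst z) (snd z)) (a t, b t) ->
  is_derive a t da -> is_derive b t db ->
  is_derive (fun s => f (a s) (b s)) t (fx (a t) (b t) * da + fy (a t) (b t) * db).
Proof.
intros Hx Hy Hc Ha Hb.
assert (Hf := is_derive_filterdiff f (a t) (b t) fx _ Hx Hy Hc).
unfold is_derive in *.
eapply filterdiff_ext_lin.
- apply (filterdiff_comp'_2 a b f t _ _ (fun x y => plus (scal x (fx (a t) (b t))) (scal y (fy (a t) (b t)))) Ha Hb).
  exact Hf.
- intros y; simpl; unfold plus, scal; simpl; unfold mult; simpl; ring.
Qed.

(** Schwarz's theorem with the derivatives as separate functions: the regularity classes
    provide them in this form, and only on an open set. *)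
Lemma mixed_partials_eq (O : R * R -> Prop) (f f1 f2 f12 f21 : R -> R -> R) :
  (forall x y, O (x, y) -> is_derive (fun x' => f x' y) x (f1 x y)) ->
  (forall x y, O (x, y) -> is_derive (fun y' => f x y') y (f2 x y)) ->
  (forall x y, O (x, y) -> is_derive (fun y' => f1 x y') y (f12 x y)) ->
  (forall x y, O (x, y) -> is_derive (fun x' => f2 x' y) x (f21 x y)) ->
  open O ->
  (forall z, O z -> continuous (fun z : R * R => f12 (fst z) (snd z)) z) ->
  (forall z, O z -> continuous (fun z : R * R => f21 (fst z) (snd z)) z) ->
  forall x y, O (x, y) -> f12 x y = f21 x y.
Proof.
intros H1 H2 H12 H21 HO Hc12 Hc21 x y Hxy.
assert (Hsx : forall x y, O (x, y) -> locally x (fun x' => O (x', y))).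
{ intros x' y' Hz; destruct (HO _ Hz) as [d Hd]; exists d; intros w Hw.
  apply Hd; split; [exact Hw | apply ball_center]. }
assert (Hsy : forall x y, O (x, y) -> locally y (fun y' => O (x, y'))).
{ intros x' y' Hz; destruct (HO _ Hz) as [d Hd]; exists d; intros w Hw.
  apply Hd; split; [apply ball_center | exact Hw]. }
assert (D12 : forall x y, O (x, y) ->
  is_derive (fun z => Derive (fun t => f t z) x) y (f12 x y)).
{ intros x' y' Hz; apply is_derive_ext_loc with (2 := H12 x' y' Hz).
  generalize (Hsy _ _ Hz); apply filter_imp; intros w Hw.
  symmetry; apply is_derive_unique, H1, Hw. }
assert (D21 : forall x y, O (x, y) ->
  is_derive (fun z => Derive (fun t => f z t) y) x (f21 x y)).
{ intros x' y' Hz; apply is_derive_ext_loc with (2 := H21 x' y' Hz).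
  generalize (Hsx _ _ Hz); apply filter_imp; intros w Hw.
  symmetry; apply is_derive_unique, H2, Hw. }
assert (HOl : locally_2d (fun u v => O (u, v)) x y).
{ apply locally_2d_locally; generalize (HO _ Hxy).
  apply filter_imp; intros [u v] Huv; exact Huv. }
transitivity (Derive (fun z => Derive (fun t => f t z) x) y).
{ symmetry; apply is_derive_unique, D12, Hxy. }
transitivity (Derive (fun z => Derive (fun t => f z t) y) x).
2: { apply is_derive_unique, D21, Hxy. }
symmetry; apply Schwarz.
- revert HOl; apply locally_2d_impl, locally_2d_forall; intros u v Huv.
  repeat split; eexists; [apply H1 | apply H2 | apply D21 | apply D12]; exact Huv.
- apply continuity_2d_pt_ext_loc with f21.
  + revert HOl; apply locally_2d_impl, locally_2d_forall; intros u v Huv.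
    symmetry; apply is_derive_unique, D21, Huv.
  + apply continuity_2d_pt_filterlim, (Hc21 (x, y) Hxy).
- apply continuity_2d_pt_ext_loc with f12.
  + revert HOl; apply locally_2d_impl, locally_2d_forall; intros u v Huv.
    symmetry; apply is_derive_unique, D12, Huv.
  + apply continuity_2d_pt_filterlim, (Hc12 (x, y) Hxy).
Qed.

(** * The integral identity for functions of class C^1 on a strip *)

Definition cont2 (f : R -> R -> R) (x t : R) : Prop :=
  continuous (fun z : R * R => f (fst z) (snd z)) (x, t).

Record C1_strip (T : R) (f fx ft : R -> R -> R) : Prop := {
  strip_dx : forall x t, 0 < t < T -> is_derive (fun y => f y t) x (fx x t);
  strip_dt : forall x t, 0 < t < T -> is_derive (fun s => f x s) t (ft x t);
  strip_c : forall x t, 0 < t < T -> cont2 f x t;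
  strip_cx : forall x t, 0 < t < T -> cont2 fx x t;
  strip_ct : forall x t, 0 < t < T -> cont2 ft x t
}.

Lemma locally_open_interval (T t : R) : 0 < t < T -> locally t (fun s : R => 0 < s < T).
Proof.
intros Ht; apply (locally_interval _ t 0 T); simpl; try lra.
intros y H1 H2; simpl in *; lra.
Qed.

Lemma cont2_slice (f : R -> R -> R) (x t : R) :
  cont2 f x t -> continuous (fun y => f y t) x.
Proof.
intros Hf; apply (continuous_comp_2 (fun y : R => y) (fun _ : R => t) f x).
- apply continuous_id.
- apply continuous_const.
- exact Hf.
Qed.

Lemma is_derive_RInt_strip (F dF : R -> R -> R) (a b T t : R) :
  0 < t < T ->
  (forall x s, 0 < s < T -> is_derive (fun s => F x s) s (dF x s)) ->
  (forall x s, 0 < s < T -> cont2 dF x s) ->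
  (forall x s, 0 < s < T -> continuous (fun y => F y s) x) ->
  is_derive (fun s => RInt (fun x => F x s) a b) t (RInt (fun x => dF x t) a b).
Proof.
intros Ht Hd Hc HF.
assert (Hloc := locally_open_interval T t Ht).
rewrite (RInt_ext (fun x => dF x t) (fun x => Derive (fun s => F x s) t)).
2: { intros x _; symmetry; apply is_derive_unique, Hd, Ht. }
apply (is_derive_RInt_param (fun s x => F x s)).
- revert Hloc; apply filter_imp; intros s Hs x _; eexists; apply Hd, Hs.
- intros x _; apply continuity_2d_pt_ext_loc with (fun s y => dF y s).
  + apply locally_2d_locally.
    destruct Hloc as [d Hloc]; exists d; intros [s y] [Hs _]; simpl.
    symmetry; apply is_derive_unique, Hd, Hloc, Hs.
  + apply continuity_2d_pt_filterlim.
    apply (continuous_comp_2 (fun z : R * R => snd z) (fun z : R * R => fst z) dF (t, x)).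
    * apply continuous_snd.
    * apply continuous_fst.
    * apply Hc, Ht.
- revert Hloc; apply filter_imp; intros s Hs.
  apply @ex_RInt_continuous; intros x _; apply HF, Hs.
Qed.

Lemma RInt_by_parts_periodic (f g f' g' : R -> R) (a : R) :
  (forall x, is_derive f x (f' x)) -> (forall x, is_derive g x (g' x)) ->
  (forall x, continuous f' x) -> (forall x, continuous g' x) ->
  periodic1 f -> periodic1 g ->
  RInt (fun x => f' x * g x) a (a + 1) = - RInt (fun x => f x * g' x) a (a + 1).
Proof.
intros Hf Hg Hf' Hg' Pf Pg.
assert (Cf : forall x, continuous f x) by (intros x; apply @ex_derive_continuous; eexists; apply Hf).
assert (Cg : forall x, continuous g x) by (intros x; apply @ex_derive_continuous; eexists; apply Hg).
assert (I := is_RInt_scal_derive f g f' g' a (a + 1)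
  (fun x _ => Hf x) (fun x _ => Hg x) (fun x _ => Hf' x) (fun x _ => Hg' x)).
apply is_RInt_unique in I.
change (RInt (fun x => f' x * g x + f x * g' x) a (a + 1)
        = f (a + 1) * g (a + 1) - f a * g a) in I.
assert (E : RInt (fun x => f' x * g x + f x * g' x) a (a + 1)
  = RInt (fun x => f' x * g x) a (a + 1) + RInt (fun x => f x * g' x) a (a + 1)).
{ apply (RInt_plus (fun x => f' x * g x) (fun x => f x * g' x));
    apply @ex_RInt_continuous; intros x _; apply @continuous_mult; auto. }
rewrite I, Pf, Pg in E; lra.
Qed.

(** Formally this is differentiation under the integral sign followed by an integration
    by parts of [v_xt f], but [v_x] has no time derivative.  Separating the two times,
    [K(r, s) := int v_x(x, r) f(x, s) dx = - int v(x, r) f_x(x, s) dx]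
    can be differentiated in [s] in its first form and in [r] in its second form, and
    the chain rule on the diagonal gives the claim. *)
Lemma is_derive_RInt_null_lagrangian (T a t : R) (v vx vt f fx ft : R -> R -> R) :
  C1_strip T v vx vt -> C1_strip T f fx ft ->
  (forall s, 0 < s < T -> periodic1 (fun x => v x s)) ->
  (forall s, 0 < s < T -> periodic1 (fun x => f x s)) ->
  0 < t < T ->
  is_derive (fun s => RInt (fun x => vx x s * f x s) a (a + 1)) t
    (RInt (fun x => vx x t * ft x t - vt x t * fx x t) a (a + 1)).
Proof.
intros Hv Hf Pv Pf Ht.
assert (Hloc := locally_open_interval T t Ht).
assert (Hparts : forall r s, 0 < r < T -> 0 < s < T ->
  RInt (fun x => vx x r * f x s) a (a + 1) = - RInt (fun x => v x r * fx x s) a (a + 1)).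
{ intros r s Hr Hs.
  apply (RInt_by_parts_periodic (fun x => v x r) (fun x => f x s) (fun x => vx x r) (fun x => fx x s)).
  - intros x; apply (strip_dx _ _ _ _ Hv), Hr.
  - intros x; apply (strip_dx _ _ _ _ Hf), Hs.
  - intros x; apply cont2_slice, (strip_cx _ _ _ _ Hv), Hr.
  - intros x; apply cont2_slice, (strip_cx _ _ _ _ Hf), Hs.
  - apply Pv, Hr.
  - apply Pf, Hs. }
assert (Hmul : forall p q : R -> R -> R, forall r s x, cont2 p x r -> cont2 q x s ->
  continuous (fun y => p y r * q y s) x).
{ intros p q r s x Hp Hq; apply @continuous_mult; apply cont2_slice; assumption. }
assert (Hring : forall p q : R, p - q = - q * 1 + p * 1) by (intros; ring).
assert (Hval : RInt (fun x => vx x t * ft x t - vt x t * fx x t) a (a + 1)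
  = - RInt (fun x => vt x t * fx x t) a (a + 1) * 1 + RInt (fun x => vx x t * ft x t) a (a + 1) * 1).
{ transitivity (RInt (fun x => vx x t * ft x t) a (a + 1) - RInt (fun x => vt x t * fx x t) a (a + 1)); [|apply Hring].
  apply (RInt_minus (fun x => vx x t * ft x t) (fun x => vt x t * fx x t));
    apply @ex_RInt_continuous; intros x _; apply Hmul;
    first [apply (strip_cx _ _ _ _ Hv), Ht | apply (strip_ct _ _ _ _ Hv), Ht
      | apply (strip_cx _ _ _ _ Hf), Ht | apply (strip_ct _ _ _ _ Hf), Ht]. }
rewrite Hval.
apply (is_derive_comp_2d
  (fun r s => RInt (fun x => vx x r * f x s) a (a + 1))
  (fun r s => - RInt (fun x => vt x r * fx x s) a (a + 1))
  (fun r s => RInt (fun x => vx x r * ft x s) a (a + 1)) (fun s => s) (fun s => s)).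
- destruct Hloc as [d Hd]; exists d; intros [r s] [Hr Hs]; simpl in *.
  apply Hd in Hr; apply Hd in Hs.
  apply is_derive_ext_loc with (fun r => - RInt (fun x => v x r * fx x s) a (a + 1)).
  { generalize (locally_open_interval T r Hr); apply filter_imp.
    intros w Hw; symmetry; apply Hparts; assumption. }
  apply @is_derive_opp.
  apply (is_derive_RInt_strip (fun x r => v x r * fx x s) (fun x r => vt x r * fx x s) a (a + 1) T r Hr).
  + intros x w Hw.
    replace (vt x w * fx x s) with (scal (fx x s) (vt x w)) by (unfold scal; simpl; unfold mult; simpl; ring).
    apply is_derive_ext with (fun w => scal (fx x s) (v x w)).
    { intros; unfold scal; simpl; unfold mult; simpl; ring. }
    apply @is_derive_scal, (strip_dt _ _ _ _ Hv), Hw.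
  + intros x w Hw; apply @continuous_mult.
    * apply (strip_ct _ _ _ _ Hv), Hw.
    * apply (continuous_comp (fun z : R * R => fst z) (fun y => fx y s)).
      { apply continuous_fst. }
      apply cont2_slice, (strip_cx _ _ _ _ Hf), Hs.
  + intros x w Hw; apply Hmul; [apply (strip_c _ _ _ _ Hv), Hw | apply (strip_cx _ _ _ _ Hf), Hs].
- apply (is_derive_RInt_strip (fun x s => vx x t * f x s) (fun x s => vx x t * ft x s) a (a + 1) T t Ht).
  + intros x w Hw; apply @is_derive_scal, (strip_dt _ _ _ _ Hf), Hw.
  + intros x w Hw; apply @continuous_mult.
    * apply (continuous_comp (fun z : R * R => fst z) (fun y => vx y t)).
      { apply continuous_fst. }
      apply cont2_slice, (strip_cx _ _ _ _ Hv), Ht.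
    * apply (strip_ct _ _ _ _ Hf), Hw.
  + intros x w Hw; apply Hmul; [apply (strip_cx _ _ _ _ Hv), Ht | apply (strip_c _ _ _ _ Hf), Hw].
- apply @continuous_opp.
  apply (continuous_RInt_param (fun x (p : R * R) => vt x (fst p) * fx x (snd p))).
  + lra.
  + intros x _; apply @continuous_mult.
    * apply (continuous_comp_2 (fun z : R * (R * R) => fst z) (fun z => fst (snd z)) vt (x, (t, t))).
      { apply continuous_fst. }
      { apply (continuous_comp (fun z : R * (R * R) => snd z) (fun z => fst z));
          [apply continuous_snd | apply continuous_fst]. }
      apply (strip_ct _ _ _ _ Hv), Ht.
    * apply (continuous_comp_2 (fun z : R * (R * R) => fst z) (fun z => snd (snd z)) fx (x, (t, t))).
      { apply continuous_fst. }
      { apply (continuous_comp (fun z : R * (R * R) => snd z) (fun z => snd z));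
          [apply continuous_snd | apply continuous_snd]. }
      apply (strip_cx _ _ _ _ Hf), Ht.
  + destruct Hloc as [d Hd]; exists d; intros [r s] [Hr Hs]; simpl in *.
    apply @ex_RInt_continuous; intros x _; apply Hmul;
      [apply (strip_ct _ _ _ _ Hv), Hd, Hr | apply (strip_cx _ _ _ _ Hf), Hd, Hs].
- apply @is_derive_id.
- apply @is_derive_id.
Qed.

(** * Regularity up to the boundary of the cylinder and on the half plane *)

Lemma locally_cylinder (T x t : R) : 0 < t < T -> locally (x, t) (cylinder T).
Proof.
intros Ht; destruct (locally_open_interval T t Ht) as [d Hd].
exists d; intros [y s] [_ Hs]; apply Hd in Hs; unfold cylinder; simpl in *; lra.
Qed.

Lemma Ck1_strip (T : R) (f : R -> R -> R) :
  Ck 1 (cylinder T) f ->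
  exists fx ft : R -> R -> R,
    continuous_on (cylinder T) (fun z => fx (fst z) (snd z)) /\ C1_strip T f fx ft.
Proof.
intros [Cf [fx [ft [[Cfx _] [[Cft _] Hd]]]]].
exists fx, ft; split; [exact Cfx|].
split; intros x t Ht; assert (Hl := locally_cylinder T x t Ht).
- apply Hd, Hl.
- apply Hd, Hl.
- exact (continuous_continuous_on _ _ _ Hl Cf).
- exact (continuous_continuous_on _ _ _ Hl Cfx).
- exact (continuous_continuous_on _ _ _ Hl Cft).
Qed.

(** Freezing a function at its boundary values for times outside [[0, T]] turns
    continuity on the closed cylinder into continuity on the plane, so that no
    one-sided limit in time has to be handled. *)
Definition clamp (T t : R) : R := Rmin T (Rmax 0 t).

Lemma clamp_id (T t : R) : 0 <= t <= T -> clamp T t = t.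
Proof. intros Ht; unfold clamp; rewrite Rmax_right, Rmin_right; lra. Qed.

Lemma clamp_range (T t : R) : 0 < T -> 0 <= clamp T t <= T.
Proof.
intros HT; unfold clamp, Rmin, Rmax.
repeat destruct Rle_dec; lra.
Qed.

Lemma continuous_clamp (T t : R) : continuous (clamp T) t.
Proof.
apply filterlim_locally; intros eps; exists eps; intros s Hs.
apply Rle_lt_trans with (2 := Hs).
change (Rabs (clamp T s - clamp T t) <= Rabs (s - t)).
unfold clamp, Rmax; destruct (Rle_dec 0 s), (Rle_dec 0 t);
  unfold Rmin; repeat destruct Rle_dec;
  unfold Rabs; repeat destruct Rcase_abs; lra.
Qed.

Lemma cont2_clamp (T : R) (f : R -> R -> R) (x t : R) :
  0 < T -> continuous_on (cylinder T) (fun z => f (fst z) (snd z)) ->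
  cont2 (fun x t => f x (clamp T t)) x t.
Proof.
intros HT Hf.
apply (filterlim_comp _ _ _ (fun z : R * R => (fst z, clamp T (snd z)))
  (fun z : R * R => f (fst z) (snd z)) _
  (within (cylinder T) (locally (x, clamp T t)))).
- intros P HP.
  assert (Hc : continuous (fun z : R * R => (fst z, clamp T (snd z))) (x, t)).
  { apply (continuous_comp_2 (fun z : R * R => fst z) (fun z : R * R => clamp T (snd z))
      (fun p q => (p, q))).
    - apply continuous_fst.
    - apply (continuous_comp (fun z : R * R => snd z) (clamp T)).
      + apply continuous_snd.
      + apply continuous_clamp.
    - apply continuous_ext with (fun z : R * R => z); [intros [p q]; reflexivity|].
      apply continuous_id. }
  assert (HN := Hc _ HP); unfold filtermap in *; revert HN.
  apply filter_imp; intros z Hz.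
  apply Hz, clamp_range, HT.
- exact (Hf (x, clamp T t) (clamp_range T t HT)).
Qed.

Lemma Ck_ext (k : nat) (D : R * R -> Prop) (f g : R -> R -> R) :
  (forall x y, D (x, y) -> f x y = g x y) -> Ck k D f -> Ck k D g.
Proof.
intros Hfg Hf.
assert (Hcont : continuous_on D (fun z : R * R => g (fst z) (snd z))).
{ apply continuous_on_ext with (fun z : R * R => f (fst z) (snd z)).
  - intros [x y] Hz; apply Hfg, Hz.
  - destruct k; apply Hf. }
destruct k as [|k]; (split; [exact Hcont|]); [exact I|].
destruct Hf as [_ [f1 [f2 [H1 [H2 Hd]]]]].
exists f1, f2; split; [exact H1|]; split; [exact H2|].
intros x y Hloc; destruct (Hd x y Hloc) as [Hx Hy]; destruct Hloc as [d Hloc].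
split.
- apply is_derive_ext_loc with (2 := Hx).
  exists d; intros w Hw; apply Hfg, Hloc; split; [exact Hw | apply ball_center].
- apply is_derive_ext_loc with (2 := Hy).
  exists d; intros w Hw; apply Hfg, Hloc; split; [apply ball_center | exact Hw].
Qed.

Lemma Ck_open_partials (k : nat) (D : R * R -> Prop) (f : R -> R -> R) :
  open D -> Ck (S k) D f ->
  Ck k D (D1 f) /\ Ck k D (D2 f) /\
  forall x y, D (x, y) ->
    is_derive (fun x' => f x' y) x (D1 f x y) /\ is_derive (fun y' => f x y') y (D2 f x y).
Proof.
intros HD [_ [f1 [f2 [H1 [H2 Hd]]]]].
assert (E : forall x y, D (x, y) -> f1 x y = D1 f x y /\ f2 x y = D2 f x y).
{ intros x y Hz; destruct (Hd x y (HD _ Hz)) as [Hx Hy].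
  split; symmetry; apply is_derive_unique; assumption. }
split; [|split].
- apply Ck_ext with (2 := H1); intros x y Hz; apply (E x y Hz).
- apply Ck_ext with (2 := H2); intros x y Hz; apply (E x y Hz).
- intros x y Hz; destruct (E x y Hz) as [<- <-]; apply (Hd x y (HD _ Hz)).
Qed.

Lemma Ck_open_cont2 (k : nat) (D : R * R -> Prop) (f : R -> R -> R) (x y : R) :
  open D -> Ck k D f -> D (x, y) -> cont2 f x y.
Proof.
intros HD Hf Hz.
apply (continuous_continuous_on D); [apply HD, Hz|].
destruct k; apply Hf.
Qed.

Lemma open_half_plane : open half_plane.
Proof.
apply (open_comp (fun z : R * R => snd z) (fun y => 0 < y)).
- intros z _; apply continuous_snd.
- apply open_gt.
Qed.

Lemma is_derive_comp_half_plane (k : nat) (F : R -> R -> R) (a b : R -> R) (x da db : R) :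
  Ck (S k) half_plane F -> 0 < b x -> is_derive a x da -> is_derive b x db ->
  is_derive (fun y => F (a y) (b y)) x (D1 F (a x) (b x) * da + D2 F (a x) (b x) * db).
Proof.
intros HF Hb Ha Hb'.
destruct (Ck_open_partials k _ _ open_half_plane HF) as [HC1 [_ Hd]].
apply is_derive_comp_2d; trivial.
- generalize (open_half_plane (a x, b x) Hb); apply filter_imp.
  intros [p q] Hq; apply Hd, Hq.
- apply Hd, Hb.
- apply (Ck_open_cont2 k half_plane); [apply open_half_plane | exact HC1 | exact Hb].
Qed.

(** * The first-order system and its ellipticity *)

(** Completing the square, [4 A Q = (2 A X + B Y)^2 + (4 A C - B^2) Y^2].  The margin [d]
    makes the discriminant strict if [B <> 0]; if [B = 0], the positivity of [A C] does. *)
Lemma pos_quadratic_form (A B C d X Y : R) :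
  0 < A -> 0 < C -> 0 < d -> 4 * A * C >= (1 + d) * B ^ 2 ->
  0 <= A * X ^ 2 + B * X * Y + C * Y ^ 2 /\
  (A * X ^ 2 + B * X * Y + C * Y ^ 2 = 0 -> X = 0 /\ Y = 0).
Proof.
intros HA HC Hd HE.
assert (HAC : 0 < A * C) by (apply Rmult_lt_0_compat; assumption).
assert (Hdisc : 0 < 4 * A * C - B ^ 2).
{ assert (HB := pow2_ge_0 B).
  destruct (Req_dec (B ^ 2) 0) as [E|N]; [lra|].
  assert (0 < d * B ^ 2) by (apply Rmult_lt_0_compat; lra).
  lra. }
set (Q := A * X ^ 2 + B * X * Y + C * Y ^ 2).
assert (HQ : 4 * A * Q = (2 * A * X + B * Y) ^ 2 + (4 * A * C - B ^ 2) * Y ^ 2)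
  by (unfold Q; ring).
assert (S1 := pow2_ge_0 (2 * A * X + B * Y)).
assert (S2 : 0 <= (4 * A * C - B ^ 2) * Y ^ 2)
  by (apply Rmult_le_pos; [lra | apply pow2_ge_0]).
split.
- apply Rmult_le_reg_l with (4 * A); lra.
- intros E; rewrite E in HQ.
  assert (HY : Y = 0).
  { destruct (Rmult_integral (4 * A * C - B ^ 2) (Y ^ 2)) as [|HY]; [lra | lra |].
    destruct (Req_dec Y 0) as [|N]; [assumption|].
    destruct (pow_nonzero Y 2 N HY). }
  split; [|exact HY]; subst Y.
  assert (HX : A * X = 0) by nra.
  destruct (Rmult_integral _ _ HX); lra.
Qed.

Lemma hamiltonian_mixed_partial (C0 gamma : R) (Cbar : R -> R) (H : R -> R -> R) (p q : R) :
  assumption_H C0 gamma Cbar H -> 0 < q -> D2 (D1 H) p q = D1 (D2 H) p q.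
Proof.
intros hH Hq.
destruct (Ck_open_partials _ _ _ open_half_plane (H_reg _ _ _ _ hH)) as [_ [HC2 HdH]].
destruct (Ck_open_partials _ _ _ open_half_plane (Hp_reg _ _ _ _ hH)) as [_ [HC12 HdH1]].
destruct (Ck_open_partials _ _ _ open_half_plane HC2) as [HC21 [_ HdH2]].
apply (mixed_partials_eq half_plane H (D1 H) (D2 H)).
- intros x y Hz; exact (proj1 (HdH x y Hz)).
- intros x y Hz; exact (proj2 (HdH x y Hz)).
- intros x y Hz; exact (proj2 (HdH1 x y Hz)).
- intros x y Hz; exact (proj1 (HdH2 x y Hz)).
- apply open_half_plane.
- intros [x y] Hz; exact (Ck_open_cont2 _ _ _ x y open_half_plane HC12 Hz).
- intros [x y] Hz; exact (Ck_open_cont2 _ _ _ x y open_half_plane HC21 Hz).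
- exact Hq.
Qed.

Lemma open_strip (T : R) : open (fun z : R * R => 0 < snd z < T).
Proof.
apply (open_comp (fun z : R * R => snd z) (fun t => 0 < t < T)).
- intros z _; apply continuous_snd.
- apply open_and; [apply open_gt | apply open_lt].
Qed.

Lemma C1_strip_comp (T : R) (psi dpsi : R -> R) (m mx mt : R -> R -> R) :
  (forall r, is_derive psi r (dpsi r)) -> (forall r, continuous dpsi r) ->
  C1_strip T m mx mt ->
  C1_strip T (fun x t => psi (m x t)) (fun x t => dpsi (m x t) * mx x t)
    (fun x t => dpsi (m x t) * mt x t).
Proof.
intros Hpsi Hdpsi Hm.
assert (Hc : forall x t, 0 < t < T -> cont2 (fun x t => dpsi (m x t)) x t).
{ intros x t Ht.
  apply (continuous_comp (fun z : R * R => m (fst z) (snd z)) dpsi).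
  - apply (strip_c _ _ _ _ Hm), Ht.
  - apply Hdpsi. }
split; intros x t Ht.
- rewrite Rmult_comm; apply (is_derive_comp psi (fun y => m y t)).
  + apply Hpsi.
  + apply (strip_dx _ _ _ _ Hm), Ht.
- rewrite Rmult_comm; apply (is_derive_comp psi (fun s => m x s)).
  + apply Hpsi.
  + apply (strip_dt _ _ _ _ Hm), Ht.
- apply (continuous_comp (fun z : R * R => m (fst z) (snd z)) psi).
  + apply (strip_c _ _ _ _ Hm), Ht.
  + apply @ex_derive_continuous; eexists; apply Hpsi.
- apply @continuous_mult; [apply Hc, Ht | apply (strip_cx _ _ _ _ Hm), Ht].
- apply @continuous_mult; [apply Hc, Ht | apply (strip_ct _ _ _ _ Hm), Ht].
Qed.

(** Here [v] is the continuous extension of [u_x] to the closed cylinder.  The first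
    equation uses [v_t = (u_t)_x], which holds as [u] is of class C^2. *)
Lemma first_order_system (C0 gamma : R) (Cbar : R -> R) (T : R)
    (H : R -> R -> R) (m0 : R -> R) (u m : R -> R -> R) :
  assumption_H C0 gamma Cbar H -> classical_system T H m0 u m ->
  exists v vx vt mx mt : R -> R -> R,
    C1_strip T v vx vt /\ C1_strip T m mx mt /\
    continuous_on (cylinder T) (fun z => vx (fst z) (snd z)) /\
    (forall t, 0 < t < T -> periodic1 (fun x => v x t)) /\
    forall x t, 0 < t < T ->
      vt x t = D1 H (v x t) (m x t) * vx x t + D2 H (v x t) (m x t) * mx x t /\
      mt x t = mx x t * D1 H (v x t) (m x t)
        + m x t * (D1 (D1 H) (v x t) (m x t) * vx x t
                   + D1 (D2 H) (v x t) (m x t) * mx x t).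
Proof.
intros hH hs.
destruct (u_reg _ _ _ _ _ hs) as [_ [u1 [u2 [Hu1 [Hu2 Hu]]]]].
destruct (Ck1_strip T u1 Hu1) as [u11 [u12 [Hc11 S1]]].
destruct (Ck1_strip T u2 Hu2) as [u21 [u22 [_ S2]]].
destruct (Ck1_strip T m (m_reg _ _ _ _ _ hs)) as [mx [mt [_ Sm]]].
assert (HD1 : forall x t, 0 < t < T -> D1 u x t = u1 x t).
{ intros x t Ht; apply is_derive_unique, Hu, locally_cylinder, Ht. }
assert (HD2 : forall x t, 0 < t < T -> D2 u x t = u2 x t).
{ intros x t Ht; apply is_derive_unique, Hu, locally_cylinder, Ht. }
assert (Hmpos : forall x t, 0 < t < T -> 0 < m x t).
{ intros x t Ht; apply (m_pos _ _ _ _ _ hs); lra. }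
assert (Hmix : forall x t, 0 < t < T -> u12 x t = u21 x t).
{ intros x t Ht.
  apply (mixed_partials_eq (fun z : R * R => 0 < snd z < T) u u1 u2).
  - intros y s Hs; apply Hu, locally_cylinder, Hs.
  - intros y s Hs; apply Hu, locally_cylinder, Hs.
  - intros y s Hs; apply (strip_dt _ _ _ _ S1), Hs.
  - intros y s Hs; apply (strip_dx _ _ _ _ S2), Hs.
  - apply open_strip.
  - intros [y s] Hs; apply (strip_ct _ _ _ _ S1 y s), Hs.
  - intros [y s] Hs; apply (strip_cx _ _ _ _ S2 y s), Hs.
  - exact Ht. }
exists u1, u11, u12, mx, mt.
split; [exact S1|]; split; [exact Sm|]; split; [exact Hc11|]; split.
- intros t Ht x.
  rewrite <- !HD1 by exact Ht.
  symmetry; apply is_derive_unique.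
  apply is_derive_ext with (fun y => u (y + 1) t).
  { intros y; apply (u_periodic _ _ _ _ _ hs); lra. }
  replace (D1 u (x + 1) t) with (scal 1 (D1 u (x + 1) t))
    by (unfold scal; simpl; unfold mult; simpl; ring).
  apply (is_derive_comp (fun y => u y t) (fun y => y + 1)).
  + rewrite HD1 by exact Ht; apply Hu, locally_cylinder, Ht.
  + auto_derive; trivial; ring.
- intros x t Ht; split.
  + rewrite Hmix by exact Ht.
    rewrite <- (is_derive_unique _ _ _ (strip_dx _ _ _ _ S2 x t Ht)).
    apply is_derive_unique.
    apply is_derive_ext with (fun y => H (u1 y t) (m y t)).
    { intros y; rewrite <- HD1, <- HD2 by exact Ht.
      assert (E := hamilton_jacobi _ _ _ _ _ hs y t Ht); lra. }
    apply (is_derive_comp_half_plane 3 H (fun y => u1 y t) (fun y => m y t)).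
    * apply (H_reg _ _ _ _ hH).
    * apply Hmpos, Ht.
    * apply (strip_dx _ _ _ _ S1), Ht.
    * apply (strip_dx _ _ _ _ Sm), Ht.
  + transitivity (D2 m x t).
    { symmetry; apply is_derive_unique, (strip_dt _ _ _ _ Sm), Ht. }
    rewrite (Rminus_diag_uniq _ _ (continuity_eq _ _ _ _ _ hs x t Ht)).
    apply is_derive_unique.
    apply is_derive_ext with (fun y => m y t * D1 H (u1 y t) (m y t)).
    { intros y; rewrite HD1 by exact Ht; reflexivity. }
    rewrite <- (hamiltonian_mixed_partial C0 gamma Cbar H _ _ hH (Hmpos x t Ht)).
    apply (is_derive_mult (fun y => m y t) (fun y => D1 H (u1 y t) (m y t))).
    * apply (strip_dx _ _ _ _ Sm), Ht.
    * apply (is_derive_comp_half_plane 3 (D1 H) (fun y => u1 y t) (fun y => m y t)).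
      { apply (Hp_reg _ _ _ _ hH). }
      { apply Hmpos, Ht. }
      { apply (strip_dx _ _ _ _ S1), Ht. }
      { apply (strip_dx _ _ _ _ Sm), Ht. }
    * intros p q; apply Rmult_comm.
Qed.

(** * Truncations of the density *)

(** The pairing [int v_x psi(m) dx] vanishes at both end times, and its derivative is the
    integral of [psi'(m)] times the positive definite form of the system.  So
    [psi'(m) m_t = 0], and each [psi(m(x, .))] keeps its initial value. *)
Lemma density_truncation_vanishes (C0 gamma : R) (Cbar : R -> R) (T : R)
    (H : R -> R -> R) (m0 : R -> R) (u m : R -> R -> R) (psi dpsi : R -> R) :
  0 < C0 -> 0 < T ->
  assumption_H C0 gamma Cbar H -> assumption_E C0 H -> classical_system T H m0 u m ->
  (forall r, is_derive psi r (dpsi r)) -> (forall r, continuous dpsi r) ->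
  (forall r, 0 <= dpsi r) ->
  (forall x, psi (m x 0) = 0) -> (forall x, psi (m x T) = 0) ->
  forall x t, 0 <= t <= T -> psi (m x t) = 0.
Proof.
intros HC0 HT hH hE hs Hpsi Hdpsi Hpos Hb0 HbT.
destruct (first_order_system _ _ _ _ _ _ _ _ hH hs)
  as [v [vx [vt [mx [mt [Sv [Sm [Hcvx [Pv Hsys]]]]]]]]].
assert (Sf := C1_strip_comp T psi dpsi m mx mt Hpsi Hdpsi Sm).
assert (HC0i : 0 < 1 / C0) by (apply Rdiv_lt_0_compat; lra).
assert (Hform : forall x t, 0 < t < T ->
  0 <= vx x t * mt x t - vt x t * mx x t /\
  (vx x t * mt x t - vt x t * mx x t = 0 -> mt x t = 0)).
{ intros x t Ht.
  destruct (Hsys x t Ht) as [Evt Emt].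
  assert (Hm : 0 < m x t) by (apply (m_pos _ _ _ _ _ hs); lra).
  assert (HE := hE (v x t) (m x t) Hm).
  assert (HHm := Hm_neg _ _ _ _ hH (v x t) (m x t) Hm).
  assert (HHpp : 0 < D1 (D1 H) (v x t) (m x t)).
  { destruct (Hpp_bounds _ _ _ _ hH (v x t) (m x t) Hm) as [Hlow _].
    apply Rlt_le_trans with (2 := Hlow).
    apply Rmult_lt_0_compat; [exact HC0i | apply exp_pos]. }
  destruct (pos_quadratic_form (m x t * D1 (D1 H) (v x t) (m x t))
    (m x t * D1 (D2 H) (v x t) (m x t)) (- D2 H (v x t) (m x t)) (1 / C0) (vx x t) (mx x t))
    as [Q1 Q2].
  - apply Rmult_lt_0_compat; assumption.
  - lra.
  - exact HC0i.
  - replace ((m x t * D1 (D2 H) (v x t) (m x t)) ^ 2)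
      with (m x t ^ 2 * D1 (D2 H) (v x t) (m x t) ^ 2) by ring.
    lra.
  - replace (vx x t * mt x t - vt x t * mx x t) with
      (m x t * D1 (D1 H) (v x t) (m x t) * vx x t ^ 2
       + m x t * D1 (D2 H) (v x t) (m x t) * vx x t * mx x t
       + - D2 H (v x t) (m x t) * mx x t ^ 2) by (rewrite Evt, Emt; ring).
    split; [exact Q1|].
    intros E; destruct (Q2 E) as [E1 E2]; rewrite Emt, E1, E2; ring. }
assert (Hcm : continuous_on (cylinder T) (fun z => psi (m (fst z) (snd z)))).
{ intros z Hz; apply (filterlim_comp _ _ _ (fun z : R * R => m (fst z) (snd z)) psi _
    (locally (m (fst z) (snd z)))).
  - apply (proj1 (m_reg _ _ _ _ _ hs)), Hz.
  - apply @ex_derive_continuous; eexists; apply Hpsi. }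
set (G := fun x t => vx x t * (dpsi (m x t) * mt x t) - vt x t * (dpsi (m x t) * mx x t)).
assert (HG : forall x t, G x t = dpsi (m x t) * (vx x t * mt x t - vt x t * mx x t))
  by (intros x t; unfold G; ring).
assert (HGpos : forall x t, 0 < t < T -> 0 <= G x t).
{ intros x t Ht; rewrite HG; apply Rmult_le_pos; [apply Hpos | apply Hform, Ht]. }
assert (HGc : forall x t, 0 < t < T -> continuous (fun y => G y t) x).
{ intros x t Ht; apply @continuous_minus; apply @continuous_mult.
  - apply cont2_slice, (strip_cx _ _ _ _ Sv), Ht.
  - apply (cont2_slice (fun x t => dpsi (m x t) * mt x t)), (strip_ct _ _ _ _ Sf), Ht.
  - apply cont2_slice, (strip_ct _ _ _ _ Sv), Ht.
  - apply (cont2_slice (fun x t => dpsi (m x t) * mx x t)), (strip_cx _ _ _ _ Sf), Ht. }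
assert (Hflat : forall x t, 0 < t < T -> dpsi (m x t) * mt x t = 0).
{ intros x t Ht.
  (* The period is centred at [x] so that [x] is interior to it. *)
  set (a := x - 1 / 2).
  assert (HI : RInt (fun y => G y t) a (a + 1) = 0).
  { apply (monotone_flat
      (fun s => RInt (fun y => vx y (clamp T s) * psi (m y (clamp T s))) a (a + 1))
      (fun s => RInt (fun y => G y s) a (a + 1)) 0 T).
    - intros s Hs.
      apply is_derive_ext_loc with (fun s => RInt (fun y => vx y s * psi (m y s)) a (a + 1)).
      { generalize (locally_open_interval T s Hs); apply filter_imp; intros w Hw.
        rewrite clamp_id by lra; reflexivity. }
      apply (is_derive_RInt_null_lagrangian T a s v vx vt _ _ _ Sv Sf Pv); [|exact Hs].
      intros w Hw y; rewrite (m_periodic _ _ _ _ _ hs w) by lra; reflexivity.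
    - intros s _.
      assert (Hc : forall y w, cont2 (fun y w => vx y (clamp T w) * psi (m y (clamp T w))) y w).
      { intros y w; apply @continuous_mult.
        - exact (cont2_clamp T vx y w HT Hcvx).
        - exact (cont2_clamp T (fun y w => psi (m y w)) y w HT Hcm). }
      apply (continuous_RInt_param (fun y w => vx y (clamp T w) * psi (m y (clamp T w)))).
      + lra.
      + intros y _; apply Hc.
      + apply filter_forall; intros w.
        apply @ex_RInt_continuous; intros y _; exact (cont2_slice _ y w (Hc y w)).
    - intros s Hs; apply RInt_ge_0; [lra | |].
      + apply @ex_RInt_continuous; intros y _; apply HGc, Hs.
      + intros y _; apply HGpos, Hs.
    - rewrite !clamp_id by lra.
      apply RInt_ext; intros y _; rewrite Hb0, HbT, !Rmult_0_r; reflexivity.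
    - exact Ht. }
  assert (Hzero : G x t = 0).
  { apply (RInt_nonneg_eq0 (fun y => G y t) a (a + 1)).
    - intros y; apply HGc, Ht.
    - intros y; apply HGpos, Ht.
    - exact HI.
    - unfold a; lra. }
  rewrite HG in Hzero.
  destruct (Rmult_integral _ _ Hzero) as [E|E].
  - rewrite E; ring.
  - rewrite (proj2 (Hform x t Ht) E); ring. }
intros x t Ht.
destruct (MVT_gen (fun s => psi (m x (clamp T s))) 0 t (fun _ => 0)) as [c [_ Hmvt]].
- rewrite Rmin_left, Rmax_right by lra; intros s Hs.
  apply is_derive_ext_loc with (fun s => psi (m x s)).
  { generalize (locally_open_interval t s Hs); apply filter_imp; intros w Hw.
    rewrite clamp_id by lra; reflexivity. }
  rewrite <- (Hflat x s) by lra.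
  apply (strip_dt _ _ _ _ Sf); lra.
- intros s _; apply continuity_pt_filterlim.
  apply (continuous_comp_2 (fun _ : R => x) (fun s : R => s) (fun y s => psi (m y (clamp T s)))).
  + apply continuous_const.
  + apply continuous_id.
  + exact (cont2_clamp T (fun y w => psi (m y w)) x s HT Hcm).
- rewrite !clamp_id, Hb0 in Hmvt by lra; lra.
Qed.

(** The square of the positive part is used, and not the positive part itself, because
    the truncation has to be of class C^1. *)
Definition pos_part_sq (r : R) : R := Rmax 0 r ^ 2.

Lemma is_derive_pos_part_sq (r : R) : is_derive pos_part_sq r (2 * Rmax 0 r).
Proof.
apply is_derive_Reals; intros eps Heps; exists (mkposreal eps Heps); intros h Hh Hlt; simpl in Hlt.
(* The derivative of [pos_part_sq] is Lipschitz with constant 2. *)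
assert (Hbound : Rabs (pos_part_sq (r + h) - pos_part_sq r - 2 * Rmax 0 r * h) <= h * h).
{ unfold pos_part_sq, Rmax; repeat destruct Rle_dec; apply Rabs_le; split; nra. }
replace ((pos_part_sq (r + h) - pos_part_sq r) / h - 2 * Rmax 0 r)
  with ((pos_part_sq (r + h) - pos_part_sq r - 2 * Rmax 0 r * h) / h) by (field; exact Hh).
rewrite Rabs_div by exact Hh.
apply Rle_lt_trans with (2 := Hlt).
assert (Hpos : 0 < Rabs h) by (apply Rabs_pos_lt, Hh).
apply Rmult_le_reg_r with (Rabs h); [exact Hpos|].
unfold Rdiv; rewrite Rmult_assoc, Rinv_l, Rmult_1_r by lra.
rewrite <- Rabs_mult, (Rabs_pos_eq (h * h)) by nra.
exact Hbound.
Qed.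

Lemma continuous_pos_part (r : R) : continuous (fun s => 2 * Rmax 0 s) r.
Proof.
apply @continuous_mult; [apply continuous_const|].
apply continuous_ext with (fun s => / 2 * (s + Rabs s)).
- intros s; unfold Rmax, Rabs; destruct Rle_dec, Rcase_abs; lra.
- apply @continuous_mult; [apply continuous_const|].
  apply @continuous_plus; [apply continuous_id | apply continuous_Rabs].
Qed.

Lemma pos_part_sq_eq0 (r : R) : r <= 0 -> pos_part_sq r = 0.
Proof. intros Hr; unfold pos_part_sq; rewrite Rmax_left by lra; ring. Qed.

Lemma pos_part_sq_eq0_inv (r : R) : pos_part_sq r = 0 -> r <= 0.
Proof.
intros Hr; apply Rnot_lt_le; intros Hlt; unfold pos_part_sq in Hr.
rewrite Rmax_right in Hr by lra; nra.
Qed.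

(** * Extrema over the torus *)

Lemma periodic1_IZR (f : R -> R) (x : R) (z : Z) : periodic1 f -> f (x + IZR z) = f x.
Proof.
intros Pf.
assert (Hn : forall n y, f (y + INR n) = f y).
{ induction n as [|n IH]; intros y.
  - simpl; rewrite Rplus_0_r; reflexivity.
  - rewrite S_INR, <- Rplus_assoc, Pf; apply IH. }
destruct (Z_le_dec 0 z) as [Hz|Hz].
- destruct (IZN z Hz) as [n ->]; rewrite <- INR_IZR_INZ; apply Hn.
- destruct (IZN (- z)) as [n E]; [lia|].
  rewrite <- (Hn n (x + IZR z)), INR_IZR_INZ, <- E, opp_IZR.
  f_equal; ring.
Qed.

Lemma periodic1_bounded_above (f : R -> R) :
  (forall x, continuous f x) -> periodic1 f -> exists M, forall x, f x <= M.
Proof.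
intros Hc Pf.
destruct (continuity_ab_maj f 0 1) as [c [Hmax _]].
- lra.
- intros x _; apply continuity_pt_filterlim, Hc.
- exists (f c); intros x.
  destruct (base_Int_part x) as [H1 H2].
  rewrite <- (periodic1_IZR f x (- Int_part x) Pf).
  apply Hmax; rewrite opp_IZR; lra.
Qed.

(** The infimum is taken in the extended reals and then projected to the reals, where
    infinite values become 0; a lower bound excludes this. *)
Lemma min_torus_le (f : R -> R) (lo x : R) : (forall y, lo <= f y) -> min_torus f <= f x.
Proof.
intros Hlo; unfold min_torus.
destruct (Glb_Rbar_correct (fun y => exists x, y = f x)) as [Hlb Hglb].
assert (H1 := Hlb (f x) (ex_intro _ x eq_refl)).
assert (H2 : Rbar_le lo (Glb_Rbar (fun y => exists x, y = f x))).
{ apply Hglb; intros y [w ->]; apply Hlo. }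
destruct (Glb_Rbar (fun y => exists x, y = f x)) as [g| |]; simpl in *; tauto.
Qed.

Lemma le_max_torus (f : R -> R) (hi x : R) : (forall y, f y <= hi) -> f x <= max_torus f.
Proof.
intros Hhi; unfold max_torus.
destruct (Lub_Rbar_correct (fun y => exists x, y = f x)) as [Hub Hlub].
assert (H1 := Hub (f x) (ex_intro _ x eq_refl)).
assert (H2 : Rbar_le (Lub_Rbar (fun y => exists x, y = f x)) hi).
{ apply Hlub; intros y [w ->]; apply Hhi. }
destruct (Lub_Rbar (fun y => exists x, y = f x)) as [g| |]; simpl in *; tauto.
Qed.

Lemma density_bounded_above (T : R) (H : R -> R -> R) (m0 : R -> R) (u m : R -> R -> R) (t : R) :
  0 < T -> classical_system T H m0 u m -> 0 <= t <= T ->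
  exists M, forall x, m x t <= M.
Proof.
intros HT hs Ht; apply periodic1_bounded_above; [|apply (m_periodic _ _ _ _ _ hs), Ht].
intros x; apply continuous_ext with (fun y => m y (clamp T t)).
{ intros y; rewrite clamp_id by exact Ht; reflexivity. }
apply (cont2_slice (fun y s => m y (clamp T s))), cont2_clamp; [exact HT|].
apply (proj1 (m_reg _ _ _ _ _ hs)).
Qed.

(** * Bounds on the density *)

Theorem corollary3p2
  (C0 gamma alpha : R) (Cbar : R -> R)
  (hC0 : 0 < C0) (hgamma : 1 < gamma) (halpha : 0 < alpha < 1)
  (hCbar_pos : forall r, 0 < r -> 0 < Cbar r)
  (hCbar_cont : forall r, 0 < r -> continuous Cbar r)
  (T : R) (hT : 0 < T)
  (H : R -> R -> R) (g m0 mT : R -> R)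
  (hM : assumption_M alpha m0 mT)
  (hH : assumption_H C0 gamma Cbar H)
  (hG : assumption_G g)
  (hE : assumption_E C0 H)
  (u m : R -> R -> R)
  (hsol : solution_MFG T H g m0 u m \/ solution_MFGP T H m0 mT u m) :
  let c1 := Rmin (min_torus m0) (min_torus (fun x => m x T)) in
  let C1 := Rmax (max_torus m0) (max_torus (fun x => m x T)) in
  forall x t : R, 0 <= t <= T -> c1 <= m x t <= C1.
Proof.
intros c1 C1 x t Ht.
assert (hs : classical_system T H m0 u m) by (destruct hsol as [[hs _]|[hs _]]; exact hs).
assert (Hinit := initial_cond _ _ _ _ _ hs).
assert (Hmpos := m_pos _ _ _ _ _ hs).
destruct (density_bounded_above T H m0 u m 0 hT hs) as [M0 HM0]; [lra|].
destruct (density_bounded_above T H m0 u m T hT hs) as [MT HMT]; [lra|].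
assert (Hend : forall s, s = 0 \/ s = T -> forall y, c1 <= m y s <= C1).
{ intros s [->| ->] y; split.
  - apply Rle_trans with (1 := Rmin_l _ _); rewrite Hinit.
    apply min_torus_le with 0; intros w; rewrite <- Hinit; apply Rlt_le, Hmpos; lra.
  - apply Rle_trans with (2 := Rmax_l _ _); rewrite Hinit.
    apply le_max_torus with M0; intros w; rewrite <- Hinit; apply HM0.
  - apply Rle_trans with (1 := Rmin_r _ _).
    apply (min_torus_le (fun w => m w T) 0); intros w; apply Rlt_le, Hmpos; lra.
  - apply Rle_trans with (2 := Rmax_r _ _).
    apply (le_max_torus (fun w => m w T) MT), HMT. }
split.
- assert (E : - pos_part_sq (c1 - m x t) = 0).
  { apply (density_truncation_vanishes C0 gamma Cbar T H m0 u m
      (fun r => - pos_part_sq (c1 - r)) (fun r => 2 * Rmax 0 (c1 - r)));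
      try assumption.
    - intros r.
      replace (2 * Rmax 0 (c1 - r)) with (opp (scal (-1) (2 * Rmax 0 (c1 - r))))
        by (unfold opp, scal; simpl; unfold mult; simpl; ring).
      apply @is_derive_opp.
      apply (is_derive_comp pos_part_sq (fun r => c1 - r)).
      + apply is_derive_pos_part_sq.
      + auto_derive; trivial; ring.
    - intros r; apply (continuous_comp (fun r => c1 - r) (fun s => 2 * Rmax 0 s)).
      + apply @continuous_minus; [apply continuous_const | apply continuous_id].
      + apply continuous_pos_part.
    - intros r; assert (B := Rmax_l 0 (c1 - r)); lra.
    - intros y; rewrite pos_part_sq_eq0; [ring|].
      assert (B := Hend 0 (or_introl eq_refl) y); lra.
    - intros y; rewrite pos_part_sq_eq0; [ring|].
      assert (B := Hend T (or_intror eq_refl) y); lra. }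
  assert (B := pos_part_sq_eq0_inv (c1 - m x t)); lra.
- assert (E : pos_part_sq (m x t - C1) = 0).
  { apply (density_truncation_vanishes C0 gamma Cbar T H m0 u m
      (fun r => pos_part_sq (r - C1)) (fun r => 2 * Rmax 0 (r - C1)));
      try assumption.
    - intros r.
      replace (2 * Rmax 0 (r - C1)) with (scal 1 (2 * Rmax 0 (r - C1)))
        by (unfold scal; simpl; unfold mult; simpl; ring).
      apply (is_derive_comp pos_part_sq (fun r => r - C1)).
      + apply is_derive_pos_part_sq.
      + auto_derive; trivial; ring.
    - intros r; apply (continuous_comp (fun r => r - C1) (fun s => 2 * Rmax 0 s)).
      + apply @continuous_minus; [apply continuous_id | apply continuous_const].
      + apply continuous_pos_part.
    - intros r; assert (B := Rmax_l 0 (r - C1)); lra.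
    - intros y; apply pos_part_sq_eq0.
      assert (B := Hend 0 (or_introl eq_refl) y); lra.
    - intros y; apply pos_part_sq_eq0.
      assert (B := Hend T (or_intror eq_refl) y); lra. }
  assert (B := pos_part_sq_eq0_inv (m x t - C1) E); lra.
Qed.
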